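(* Let $n,q\in\mathbb{N}$ with $q\ge2$. The map $\varphi:\mathbb{Z}_q^n\to\mathbb{Z}_{q^n}$, $\varphi(a_1,\dots,a_n)=a_1q^{n-1}+a_2q^{n-2}+\dots+a_{n-1}q+a_n \pmod{q^n}$ (with each $a_j$ represented in $\{0,\dots,q-1\}$), is an isometry $(\mathbb{Z}_q^n,d_{RT})\to(\mathbb{Z}_{q^n},d_q)$.
   Context: The $q$-adic metric on $\mathbb{Z}_{q^n}$ is $d_q(x,y)=\min\{i\in\{0,\dots,n\}: q^{n-i}\mid x-y\}$ (divisibility of any integer representative of $x-y$; well defined since $q^{n-i}\mid q^n$). The Rosenbloom–Tsfasman metric on $\mathbb{Z}_q^n$ is $d_{RT}(x,y)=\max\{1\le i\le n: x_i\ne y_i\}$ for $x\ne y$, and $d_{RT}(x,x)=0$. An isometry is a distance-preserving bijection. *)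

(* Defs.v *)
From mathcomp Require Import all_boot all_algebra.

Set Implicit Arguments.
Unset Strict Implicit.
Unset Printing Implicit Defensive.

Import GRing.Theory.

Local Open Scope nat_scope.

(* The additive group of integers modulo m, for every m >= 1.  Unlike ['Z_m],
   which is Z/2 when m <= 1, this is the trivial group for m = 1, hence
   [Zmod (q ^ n)] is also correct for n = 0. *)
Notation Zmod m := 'I_(m.-1.+1).

(* Coordinates are numbered from 0, hence the [i.+1]; the empty maximum,
   i.e. the case x = y, is 0. *)
Definition d_RT (q n : nat) (x y : 'rV[Zmod q]_n) : nat :=
  \max_(i < n | x ord0 i != y ord0 i) i.+1.

(* [x - y] is computed in Zmod (q ^ n) and then read as a natural number; by
   [dvdn_Zmod_repr] any other integer representative gives the same result.
   The starting point [ord_max] of the search, i.e. i = n, always satisfies the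
   divisibility condition. *)
Definition d_q (q n : nat) (x y : Zmod (q ^ n)) : nat :=
  [arg min_(i < (ord_max : 'I_n.+1) | q ^ (n - i) %| (x - y)%R) (i : nat)].

Definition phi (q n : nat) (a : 'rV[Zmod q]_n) : Zmod (q ^ n) :=
  inZp (\sum_(j < n) a ord0 j * q ^ (n - j.+1)).

Definition is_isometry (X Y : Type) (dX : X -> X -> nat) (dY : Y -> Y -> nat)
    (f : X -> Y) : Prop :=
  bijective f /\ forall x y : X, dY (f x) (f y) = dX x y.

Lemma dvdn_Zmod_repr (q n i : nat) (u : Zmod (q ^ n)) (z : int) :
  (z = (u : nat)%:Z %[mod (q ^ n)%N%:Z])%Z ->
  ((q ^ (n - i))%N%:Z %| z)%Z = (q ^ (n - i) %| u).
Proof.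
move=> zu; have dv : ((q ^ (n - i))%N%:Z %| (q ^ n)%N%:Z)%Z.
  by rewrite dvdzE /= dvdn_exp2l // leq_subr.
have dzu : ((q ^ (n - i))%N%:Z %| (z - Posz u)%R)%Z.
  by apply: (dvdz_trans dv); rewrite -eqz_mod_dvd; apply/eqP.
by rewrite -(subrK (Posz u) z) (rpredDl _ dzu) dvdzE.
Qed.

(* Main.v *)
(* Reducing [phi a] modulo [q ^ m] keeps exactly the last [m] base-[q] digits.
   Hence [q ^ (n - i)] divides [phi x - phi y] if and only if [x] and [y] agree
   at all (0-based) positions [>= i]; the least such [i] is [d_RT x y].  The
   case [m = n] gives injectivity, and bijectivity follows by counting. *)
Require Import Defs.
From mathcomp Require Import all_boot all_algebra.
From mathcomp Require Import zify.

Set Implicit Arguments.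
Unset Strict Implicit.
Unset Printing Implicit Defensive.

(** For [t < q], reducing [z * q + t] modulo [d * q] gives [z %% d * q + t], even for [d = 0].
    Remainder and quotient by [q] then separate the two parts. *)
Lemma eqn_modMDr (q d x y r s : nat) : r < q -> s < q ->
  (x * q + r == y * q + s %[mod d * q]) = (x == y %[mod d]) && (r == s).
Proof.
move=> rq sq; have q0 : 0 < q by apply: leq_ltn_trans rq.
have modMD z t : t < q -> (z * q + t) %% (d * q) = z %% d * q + t.
  move=> tq; case: (posnP d) => [->|d0]; first by rewrite mul0n !modn0.
  rewrite {1}(divn_eq z d) mulnDl -addnA -mulnA modnMDl modn_small //.
  have lt_zd : z %% d < d by rewrite ltn_mod.
  by nia.
rewrite !modMD //; apply/eqP/andP => [e|[/eqP-> /eqP->] //].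
have := congr1 (modn^~ q) e; rewrite /= !modnMDl (modn_small rq) (modn_small sq) => ->.
have := congr1 (divn^~ q) e; rewrite /= !divnMDl //.
by rewrite (divn_small rq) (divn_small sq) !addn0 => ->.
Qed.

(** Simultaneous induction on [n] and [m]: Horner's rule ([sumS]) splits off the last digit, and
    [eqn_modMDr] compares it separately. Digit sequences are total on [nat], so shortening the word
    leaves them unchanged. *)
Lemma digits_eqmodP (q n m : nat) (a b : nat -> nat) :
    (forall j, a j < q) -> (forall j, b j < q) -> m <= n ->
  reflect (forall j, n - m <= j < n -> a j = b j)
    (\sum_(j < n) a j * q ^ (n - j.+1) == \sum_(j < n) b j * q ^ (n - j.+1)
       %[mod q ^ m]).
Proof.
move=> aq bq.
have sumS (c : nat -> nat) k : \sum_(j < k.+1) c j * q ^ (k.+1 - j.+1)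
    = (\sum_(j < k) c j * q ^ (k - j.+1)) * q + c k.
  rewrite big_ord_recr /= subnn muln1 big_distrl /=; congr (_ + _).
  by apply: eq_bigr => j _; rewrite -mulnA -expnSr subSS -subSn.
elim: n m => [|n IHn] [|m] le_mn //.
- by rewrite expn0 !modn1; apply: ReflectT => j; rewrite andbF.
- rewrite expn0 !modn1 subn0; apply: ReflectT => j.
  by case/andP=> /leq_trans le /le; rewrite ltnn.
rewrite !sumS expnSr eqn_modMDr // subSS.
apply: (iffP andP) => [[/(IHn _ le_mn) eq_ab /eqP eqn] j|eq_ab].
  case/andP=> le_j; rewrite ltnS leq_eqVlt => /predU1P[-> //|lt_j].
  by apply: eq_ab; rewrite le_j.
split; last by apply/eqP/eq_ab; rewrite leq_subr leqnn.
by apply/(IHn _ le_mn) => j /andP[le_j /ltnW lt_j]; apply: eq_ab; rewrite le_j.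
Qed.

Lemma dvdn_Zmod_sub (N d : nat) (x y : Zmod N) : 0 < N -> d %| N ->
  (d %| (x - y)%R) = (x == y %[mod d]).
Proof.
case: N x y => // N x y _ dN /=.
rewrite /dvdn modnDmr modn_dvdm // -[_ %% d == 0]/(d %| _).
(* Adding the representative [N.+1 - y] of [-y] to both sides turns the right one into [N.+1], which
   vanishes modulo [d]. *)
rewrite -(eqn_modDr (N.+1 - y)) (subnKC (ltnW (ltn_ord y))).
by rewrite (eqP dN).
Qed.

Lemma phi_eqmodP (q n m : nat) (x y : 'rV[Zmod q]_n) : 0 < q -> m <= n ->
  reflect (forall i : 'I_n, n - m <= i -> x ord0 i = y ord0 i)
    (phi x == phi y %[mod q ^ m]).
Proof.
move=> q0 le_mn.
(* Extend the row by 0 past position [n]; since [0 < q], this is still a digit. *)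
pose digit (z : 'rV[Zmod q]_n) j := oapp (fun i => z ord0 i : nat) 0 (insub j).
have digit_lt z j : digit z j < q.
  rewrite /digit; case: insub => //= i.
  by rewrite (leq_trans (ltn_ord _)) ?prednK.
have digitE z (i : 'I_n) : digit z i = z ord0 i by rewrite /digit valK.
have phiE z : phi z = \sum_(j < n) digit z j * q ^ (n - j.+1) %[mod q ^ m].
  rewrite /phi /= (prednK (_ : 0 < q ^ n)) ?expn_gt0 ?q0 //.
  rewrite modn_dvdm ?dvdn_exp2l //.
  by under [in RHS]eq_bigr => j _ do rewrite digitE.
rewrite !phiE.
apply: (iffP (digits_eqmodP _ _ _)) => // [eq_xy i le_i|eq_xy j].
  by apply: val_inj; rewrite /= -!digitE eq_xy // le_i /=.
case/andP=> le_j lt_j; rewrite -[j]/(val (Ordinal lt_j)) !digitE.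
by rewrite eq_xy.
Qed.

Theorem theorem5p2 (n q : nat) (hq : 2 <= q) :
  is_isometry (@d_RT q n) (@d_q q n) (@phi q n).
Proof.
have q0 : 0 < q by apply: ltnW.
split=> [|x y].
  apply: inj_card_bij => [x y eq_xy|].
    apply/rowP => i; have /phi_eqmodP : phi x == phi y %[mod q ^ n].
      by rewrite eq_xy.
    by apply; rewrite // subnn.
  by rewrite card_mx !card_ord mul1n !prednK ?expn_gt0 ?q0.
(* Take [m = n - i] in [phi_eqmodP]. Then [n - m] is the minimum of [i] and [n], so [j < n] makes
   its bound equivalent to [i <= j], even when [i > n]. *)
have dvdP i : reflect (forall j : 'I_n, i <= j -> x ord0 j = y ord0 j)
    (q ^ (n - i) %| (phi x - phi y)%R).
  rewrite dvdn_Zmod_sub ?expn_gt0 ?q0 ?dvdn_exp2l ?leq_subr //.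
  apply: (iffP (phi_eqmodP _ _ _ _)); rewrite ?leq_subr // => eq_xy j le_j.
    by apply: eq_xy; lia.
  by apply: eq_xy; have := ltn_ord j; lia.
rewrite /d_q /d_RT; case: arg_minnP => [|i /dvdP eq_xy min_i].
  by rewrite subnn expn0 dvd1n.
(* First, [d] is itself a candidate for the minimum: a differing position [j] has [j.+1 <= d].
   Conversely, [j.+1 <= i] at every differing [j], because the rows agree from [i] on. *)
set d := \max_(_ < n | _) _; apply/eqP; rewrite eqn_leq; apply/andP; split.
  have lt_d : d < n.+1 by rewrite ltnS; apply/bigmax_leqP => j _.
  apply: (min_i (Ordinal lt_d)); apply/dvdP => j /= le_j; apply/eqP.
  apply: contraLR le_j => neq; rewrite -ltnNge.
  exact: (@leq_bigmax_cond _ _ (fun j : 'I_n => j.+1)).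
by apply/bigmax_leqP => j; apply: contraR; rewrite -ltnNge ltnS => /eq_xy->.
Qed.
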